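(* The language of URC formulas is strictly more succinct than the language of PC formulas. That is: (i) there is a polynomial $p$ such that every PC formula $\varphi$ has an equivalent URC formula $\psi$ with $|\psi|\le p(|\varphi|)$; and (ii) there is no polynomial $p$ such that every URC formula $\varphi$ has an equivalent PC formula $\psi$ with $|\psi|\le p(|\varphi|)$.
   Context: A CNF formula is a conjunction (set) of clauses; a clause is a disjunction (set) of literals; $|\varphi|$ denotes the number of clauses of $\varphi$. A partial assignment $\alpha$ of variables $\mathbf{x}$ is a set of literals on $\mathbf{x}$ containing no complementary pair; it is identified with the conjunction of its literals. The unit resolution rule derives the clause $C\setminus\{l\}$ from a clause $C\ni l$ and the unit clause $\neg l$; $\varphi\vdash_1 C$ means $C$ can be derived from $\varphi$ by repeated applications of this rule, and $\bot$ denotes the empty clause. A CNF formula $\varphi(\mathbf{x})$ is unit refutation complete (URC) if for every partial assignment $\alpha$ of $\mathbf{x}$, $\varphi\wedge\alpha\models\bot$ implies $\varphi\wedge\alpha\vdash_1\bot$. It is propagation complete (PC) if for every partial assignment $\alpha$ of $\mathbf{x}$ and every literal $l$ on $\mathbf{x}$ with $\varphi\wedge\alpha\models l$, we have $\varphi\wedge\alpha\vdash_1 l$ or $\varphi\wedge\alpha\vdash_1\bot$. URC formulas and PC formulas are formulas using no auxiliary variables, and ''equivalent'' means representing the same Boolean function on the same variables. For representation languages $L_1,L_2$: $L_1$ is at least as succinct as $L_2$ iff there is a polynomial $p$ such that for every $\varphi\in L_2$ there is an equivalent $\psi\in L_1$ with $|\psi|\le p(|\varphi|)$; $L_1$ is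 strictly more succinct than $L_2$ if $L_1$ is at least as succinct as $L_2$ but not vice versa. *)

(* Defs.v *)
From HB Require Import structures.
From mathcomp Require Import all_boot all_order all_algebra.

Set Implicit Arguments.
Unset Strict Implicit.
Unset Printing Implicit Defensive.

Section Cnf.
Variable V : finType.

(* The literal (v, true) is v, and (v, false) is the negation of v. *)
Definition literal : Type := (V * bool)%type.
Definition neg (l : literal) : literal := (l.1, ~~ l.2).

Definition clause : Type := {set V * bool}.
Definition cnf : Type := {set {set V * bool}}.

Definition empty_clause : clause := set0.
Definition unit_clause (l : literal) : clause := [set l].

Definition total_assignment : Type := {ffun V -> bool}.

Definition sat_literal (a : total_assignment) (l : literal) : bool :=
  a l.1 == l.2.
Definition sat_clause (a : total_assignment) (C : clause) : bool :=
  [exists l in C, sat_literal a l].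
Definition sat_cnf (a : total_assignment) (phi : cnf) : bool :=
  [forall C in phi, sat_clause a C].

Definition entails (phi : cnf) (C : clause) : Prop :=
  forall a : total_assignment, sat_cnf a phi -> sat_clause a C.

Definition equivalent (phi psi : cnf) : Prop :=
  forall a : total_assignment, sat_cnf a phi = sat_cnf a psi.

Definition partial_assignment (alpha : {set literal}) : Prop :=
  forall l : literal, l \in alpha -> neg l \notin alpha.

Definition conj_assignment (phi : cnf) (alpha : {set literal}) : cnf :=
  phi :|: [set unit_clause l | l in alpha].

Inductive unit_derives (phi : cnf) : clause -> Prop :=
| unit_derives_axiom (C : clause) : C \in phi -> unit_derives phi C
| unit_derives_resolve (C : clause) (l : literal) :
    unit_derives phi C -> l \in C ->
    unit_derives phi (unit_clause (neg l)) ->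
    unit_derives phi (C :\ l).

Definition URC (phi : cnf) : Prop :=
  forall alpha : {set literal}, partial_assignment alpha ->
    entails (conj_assignment phi alpha) empty_clause ->
    unit_derives (conj_assignment phi alpha) empty_clause.

Definition PC (phi : cnf) : Prop :=
  forall (alpha : {set literal}) (l : literal), partial_assignment alpha ->
    entails (conj_assignment phi alpha) (unit_clause l) ->
    unit_derives (conj_assignment phi alpha) (unit_clause l) \/
    unit_derives (conj_assignment phi alpha) empty_clause.

End Cnf.

(* A language selects CNF formulas over each finite set V of variables;
   equivalent formulas are over the same V, so no auxiliary variables occur. *)
Definition language : Type := forall V : finType, cnf V -> Prop.

Definition at_least_as_succinct (L1 L2 : language) : Prop :=
  exists p : {poly rat}, forall (V : finType) (phi : cnf V), L2 V phi ->
    exists psi : cnf V,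
      [/\ L1 V psi, equivalent phi psi
        & (#|psi|%:R <= p.[#|phi|%:R])%R].

Definition strictly_more_succinct (L1 L2 : language) : Prop :=
  at_least_as_succinct L1 L2 /\ ~ at_least_as_succinct L2 L1.

(* Main.v *)
Require Import Defs.
From HB Require Import structures.
From mathcomp Require Import all_boot all_order all_algebra.
From mathcomp Require Import zify.

(** A PC formula is already URC: if a contradiction is entailed then both [l]
    and its negation are entailed for any literal [l], and one more unit
    resolution gives the empty clause.

    For the separation consider the Horn formula with clauses
    [x_(i,b) /\ w -> z_i] (for [i < n] and [b] Boolean) and
    [z_0 /\ ... /\ z_(n-1) -> t].  Like every Horn formula it is URC.
    For each [f : 'I_n -> bool] the assignment setting all [x_(i, f i)] to true
    and [t] to false entails, besides its own literals, only the negation of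
    [w]; hence an equivalent PC formula must contain a clause propagating it,
    and since [/\_i x_(i, f i) /\ w -> t] is a prime implicate this clause is
    exactly that implicate.  So an equivalent PC formula has at least [2 ^ n]
    clauses, against [2 n + 1]. *)

Set Implicit Arguments.
Unset Strict Implicit.
Unset Printing Implicit Defensive.

(** * Unit resolution on Horn and PC formulas *)

Section Cnf.
Variable V : finType.
Implicit Types (phi psi : cnf V) (C : clause V) (a : total_assignment V).

Lemma negK : involutive (@neg V).
Proof. by move=> [v b]; rewrite /neg /= negbK. Qed.

Lemma sat_cnf_conj a phi (alpha : {set literal V}) :
  sat_cnf a (conj_assignment phi alpha) =
  sat_cnf a phi && [forall l in alpha, sat_literal a l].
Proof.
apply/forall_inP/andP => [H|[/forall_inP H1 /forall_inP H2] C].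
  split; apply/forall_inP; first by move=> C Cphi; apply: H; rewrite inE Cphi.
  move=> l la.
  have /H/exists_inP[l'] : unit_clause l \in conj_assignment phi alpha.
    by rewrite inE; apply/orP; right; apply: imset_f.
  by rewrite inE => /eqP->.
rewrite inE => /orP[/H1//|/imsetP[l la ->]].
by apply/exists_inP; exists l; [rewrite inE|apply: H2].
Qed.

(** Iterated unit resolution; [uniq s] ensures that each literal is still present when its turn
    comes. *)
Lemma unit_derives_setD phi C (s : seq (literal V)) :
  unit_derives phi C -> uniq s -> {subset s <= C} ->
  (forall l, l \in s -> unit_derives phi (unit_clause (neg l))) ->
  unit_derives phi (C :\: [set l in s]).
Proof.
elim: s C => [|l s IHs] C dC /=.
  by move=> _ _ _; rewrite set_nil setD0.
move=> /andP[ls us] sC ds.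
rewrite set_cons -setDDl; apply: IHs => //.
- apply: unit_derives_resolve => //; first by apply: sC; rewrite mem_head.
  by apply: ds; rewrite mem_head.
- move=> m ms; rewrite !inE sC ?inE ?ms ?orbT // andbT.
  by apply: contraNneq ls => <-.
- by move=> m ms; apply: ds; rewrite inE ms orbT.
Qed.

Definition horn phi :=
  forall C, C \in phi -> #|[set v : V | (v, true) \in C]| <= 1.

(* The assignment true exactly on [S] falsifies some clause; since the negative
   literals of this clause can be resolved away, either it yields the empty
   clause or a new variable can be added to [S]. *)
Lemma horn_unit_refutation_from phi (S : {set V}) :
  horn phi -> entails phi (empty_clause V) ->
  (forall v, v \in S -> unit_derives phi (unit_clause (v, true))) ->
  unit_derives phi (empty_clause V).
Proof.
move=> hphi unsat; have [k] := ubnP #|~: S|; elim: k S => // k IHk S kS dS.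
have /forall_inPn[C Cphi nC] : ~~ sat_cnf [ffun v => v \in S] phi.
  by apply/negP => /unsat /exists_inP[l]; rewrite inE.
have CS v b : (v, b) \in C -> (v \in S) = ~~ b.
  move=> vC; apply: contraNeq nC => vb; apply/exists_inP; exists (v, b) => //.
  by rewrite /sat_literal ffunE; move: vb; case: (v \in S); case: b {vC}.
pose N := [set l in C | ~~ l.2].
have dCN : unit_derives phi (C :\: N).
  rewrite -[N]set_enum; apply: unit_derives_setD.
  - exact: unit_derives_axiom.
  - exact: enum_uniq.
  - by move=> l; rewrite mem_enum inE => /andP[].
  - move=> [v b]; rewrite mem_enum inE /= => /andP[vC nb].
    by rewrite /neg /= nb; apply: dS; rewrite (CS _ _ vC).
have [/existsP[v vC]|nv] := boolP [exists v, (v, true) \in C]; last first.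
  suff -> : empty_clause V = C :\: N by [].
  apply/esym/eqP; rewrite setD_eq0; apply/subsetP => -[v b] vC.
  rewrite inE vC /=; case: b vC => // vC.
  by rewrite -(negbK true); move/existsPn: nv => /(_ v); rewrite vC.
have dv : unit_derives phi (unit_clause (v, true)).
  suff -> : unit_clause (v, true) = C :\: N by [].
  apply/setP => -[u b]; rewrite !inE; case: b; rewrite /= ?andbF /=; last first.
    by rewrite andbT xpair_eqE andbF andNb.
  apply/eqP/idP => [->//|uC]; congr (_, _).
  by apply: (card_le1_eqP (hphi _ Cphi)); rewrite inE.
apply: (IHk (v |: S)) => [|u].
  rewrite setCU [~: [set v] :&: _]setIC -setDE.
  have vS : v \in ~: S by rewrite inE (CS _ _ vC).
  by move: kS; rewrite (cardsD1 v (~: S)) vS.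
by rewrite !inE => /orP[/eqP->|/dS].
Qed.

(** Adding unit clauses keeps a formula Horn, so the saturation can start from the empty set of
    variables. *)
Lemma horn_URC phi : horn phi -> URC phi.
Proof.
move=> hphi alpha _ unsat.
apply: (@horn_unit_refutation_from _ set0) => // [C|v]; last by rewrite inE.
rewrite inE => /orP[/hphi//|/imsetP[l _ ->]].
apply/card_le1_eqP => u v; rewrite !inE.
by move=> /eqP [] e /eqP; rewrite -e => -[].
Qed.

Lemma PC_URC phi : PC phi -> URC phi.
Proof.
move=> pc alpha pa unsat.
have ent C : entails (conj_assignment phi alpha) C.
  by move=> a /unsat /exists_inP[l]; rewrite inE.
have [v _|V0] := pickP V.
  have [dp|//] := pc alpha (v, true) pa (ent _).
  have [dn|//] := pc alpha (v, false) pa (ent _).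
  have -> : empty_clause V = unit_clause (v, true) :\ (v, true).
    by rewrite setDv.
  by apply: unit_derives_resolve; rewrite ?inE.
(* With no variables there is no literal to propagate, but an unsatisfiable formula then contains a
   clause, necessarily empty. *)
have /forall_inPn[C Cphi _] :
    ~~ sat_cnf [ffun=> true] (conj_assignment phi alpha).
  by apply/negP => /unsat /exists_inP[l]; rewrite inE.
have -> : empty_clause V = C by apply/setP => -[v b]; have := V0 v.
exact: unit_derives_axiom.
Qed.

(* If no clause of [phi] propagates anything new under [alpha], then every
   clause derived is satisfied by [alpha] or keeps two literals that [alpha]
   does not falsify. *)
Lemma propagating_clause phi (alpha : {set literal V}) C :
  partial_assignment alpha ->
  unit_derives (conj_assignment phi alpha) C ->
  [disjoint C & alpha] -> #|[set l in C | neg l \notin alpha]| <= 1 ->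
  exists2 D, D \in phi &
    [disjoint D & alpha] /\ #|[set l in D | neg l \notin alpha]| <= 1.
Proof.
move=> pa.
elim=> {C} [C|C l _ IHC lC _ IHl].
  rewrite inE => /orP[Cphi dC cC|/imsetP[l la ->]]; first by exists C.
  by move=> /pred0P /(_ l); rewrite /= inE eqxx la.
(* If [neg l] is not in [alpha], the unit premise itself meets the two conditions. Otherwise [alpha]
   falsifies [l], so putting [l] back keeps both conditions for [C]. *)
move=> dC cC; have [la|nla] := boolP (neg l \in alpha); last first.
  apply: IHl; first by rewrite disjoints1.
  apply: leq_trans (subset_leq_card _) (eq_leq (cards1 (neg l))).
  by apply/subsetP => m; rewrite !inE => /andP[].
have lna : l \notin alpha by rewrite -[l]negK pa.
apply: IHC.
  apply/pred0P => m /=; apply/negP => /andP[mC ma].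
  move/pred0P: dC => /(_ m) /=; rewrite !inE mC ma !andbT.
  by move=> /negbFE/eqP ml; rewrite -ml ma in lna.
apply: leq_trans cC; apply: subset_leq_card; apply/subsetP => m.
rewrite !inE => /andP[-> nm]; rewrite nm !andbT.
by apply: contraNneq nm => ->.
Qed.

End Cnf.

(** * The selector formulas and their choice implicates *)

Section Selector.
Variable n : nat.

Definition svar : finType := (('I_n * option bool) + bool)%type.
Definition x_ (i : 'I_n) (b : bool) : svar := inl (i, Some b).
Definition z_ (i : 'I_n) : svar := inl (i, None).
Definition w_ : svar := inr true.
Definition t_ : svar := inr false.

Definition select_clause (ib : 'I_n * bool) : clause svar :=
  [set (x_ ib.1 ib.2, false); (w_, false); (z_ ib.1, true)].
Definition target_clause : clause svar :=
  (t_, true) |: [set (z_ i, false) | i : 'I_n].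
Definition selector : cnf svar :=
  target_clause |: [set select_clause ib | ib : 'I_n * bool].

Lemma card_selector : #|selector| <= n.*2.+1.
Proof.
rewrite cardsU1 -add1n leq_add ?leq_b1 //.
apply: leq_trans (leq_imset_card _ _) _.
by rewrite card_prod card_ord card_bool muln2.
Qed.

Lemma horn_selector : horn selector.
Proof.
move=> C; rewrite inE => /orP[|/imsetP[[i b] _ ->]].
  rewrite inE => /eqP->; apply/card_le1_eqP.
  suff H u : u \in [set v | (v, true) \in target_clause] -> u = t_.
    by move=> u v /H-> /H->.
  rewrite !inE => /orP[/eqP[]//|/imsetP[i _ []]//].
apply/card_le1_eqP.
suff H u : u \in [set v | (v, true) \in select_clause (i, b)] -> u = z_ i.
  by move=> u v /H-> /H->.
by rewrite !inE => /orP[/orP[]|] /eqP[].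
Qed.

Lemma sat_selector (a : total_assignment svar) :
  reflect ((forall i b, a (x_ i b) -> a w_ -> a (z_ i)) /\
           ((forall i, a (z_ i)) -> a t_))
          (sat_cnf a selector).
Proof.
apply: (iffP forall_inP) => [H|[Hx Ht] C].
  split=> [i b ax aw|az].
    have /H/exists_inP[l] : select_clause (i, b) \in selector.
      by rewrite inE imset_f ?orbT.
    by rewrite !inE => /orP[/orP[]|] /eqP->; rewrite /sat_literal /= ?ax ?aw // => /eqP.
  have /H/exists_inP[l] : target_clause \in selector by rewrite setU11.
  rewrite !inE => /orP[/eqP->|/imsetP[i _ ->]]; rewrite /sat_literal /=.
    by move/eqP.
  by rewrite az.
rewrite inE => /orP[|/imsetP[[i b] _ ->]].
  rewrite inE => /eqP->.
  have [/forallP az|/forallPn[i az]] := boolP [forall i, a (z_ i)].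
    apply/exists_inP; exists (t_, true); rewrite ?setU11 // /sat_literal /=.
    by rewrite Ht.
  apply/exists_inP; exists (z_ i, false); last by rewrite /sat_literal /= (negPf az).
  by rewrite inE imset_f ?orbT.
have [ax|ax] := boolP (a (x_ i b)); last first.
  apply/exists_inP; exists (x_ i b, false); rewrite ?inE ?eqxx //.
  by rewrite /sat_literal /= (negPf ax).
have [aw|aw] := boolP (a w_); last first.
  apply/exists_inP; exists (w_, false); rewrite ?inE ?eqxx ?orbT //.
  by rewrite /sat_literal /= (negPf aw).
apply/exists_inP; exists (z_ i, true); rewrite ?inE ?eqxx ?orbT //.
by rewrite /sat_literal /= (Hx i b).
Qed.

Implicit Type f : {ffun 'I_n -> bool}.

Definition choice_assignment f : {set literal svar} :=
  (t_, false) |: [set (x_ i (f i), true) | i : 'I_n].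

Definition choice_clause f : clause svar :=
  (w_, false) |: [set neg l | l in choice_assignment f].

Lemma mem_choice_assignment f v b :
  ((v, b) \in choice_assignment f) =
  match v with
  | inl (i, Some c) => b && (c == f i)
  | inl (_, None) => false
  | inr c => ~~ c && ~~ b
  end.
Proof.
rewrite !inE xpair_eqE.
case: v => [[i [c|]]|c] /=; last first.
- have -> : ((inr c, b) \in [set (x_ i (f i), true) | i : 'I_n]) = false.
    by apply/imsetP => -[].
  by rewrite orbF; case: b c => [] [].
- by apply/imsetP => -[].
apply/imsetP/andP => [[j _ [-> -> ->]]//|[-> /eqP->]].
by exists i.
Qed.

Lemma partial_choice_assignment f : partial_assignment (choice_assignment f).
Proof.
move=> [v b]; rewrite /neg !mem_choice_assignment.
by case: v => [[i [c|]]|c] //=; case: b => //=; rewrite ?andbF.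
Qed.

(** If [w_] held, every [x_ i (f i)] would force [z_ i], hence [t_], which is set to false. *)
Lemma choice_assignment_entails f :
  entails (conj_assignment selector (choice_assignment f))
          (unit_clause (w_, false)).
Proof.
move=> a; rewrite sat_cnf_conj => /andP[/sat_selector[Hx Ht] /forall_inP Ha].
apply/exists_inP; exists (w_, false); rewrite ?inE // /sat_literal /= eqbF_neg.
apply/negP => aw.
have := Ha (t_, false); rewrite mem_choice_assignment /sat_literal /=.
rewrite Ht => [/(_ isT)//|i]; apply: (Hx i (f i)) => //.
have := Ha (x_ i (f i), true).
by rewrite mem_choice_assignment /sat_literal /= eqxx => /(_ isT)/eqP.
Qed.

(** Models of the formula extending the assignment show that the one unfalsified literal of [C] is
    the negation of [w_], so [C] is included in [choice_clause f]; primality of the latter gives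
    equality. *)
Lemma propagating_implicate_choice f (C : clause svar) : 1 < n ->
  entails selector C -> [disjoint C & choice_assignment f] ->
  #|[set l in C | neg l \notin choice_assignment f]| <= 1 ->
  C = choice_clause f.
Proof.
move=> n2 impl dC /card_le1_eqP cC.
have satP (a : total_assignment svar) : sat_cnf a selector ->
    exists v, (v, a v) \in C.
  by move=> /impl/exists_inP[[v b] vC /eqP /= e]; exists v; rewrite e.
(* A model of the selector formula unless [v] is [w_] or [t_]. *)
pose model (v : svar) : total_assignment svar :=
  [ffun u => ((u, true) \in choice_assignment f) || (u == v)].
have freeP v : v != w_ -> v != t_ ->
    exists2 u, (u, model v u) \in C & neg (u, model v u) \notin choice_assignment f.
  move=> vw vt; have [|u uC] := satP (model v).
    apply/sat_selector; split=> [i b _|az].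
      by rewrite ffunE mem_choice_assignment /= eq_sym (negPf vw).
    (* Only [v] can be a true [z_] variable, and [1 < n] provides two of them. *)
    have := az (Ordinal (ltnW n2)); have := az (Ordinal n2).
    by rewrite !ffunE !mem_choice_assignment /= => /eqP<-.
  exists u => //; rewrite /neg /=; have [mu|] := boolP (model v u).
    apply/negP => uf; move: mu; rewrite ffunE => /orP[ut|/eqP uv].
      by have := partial_choice_assignment uf; rewrite /neg /= ut.
    move: uf vw vt; rewrite -uv mem_choice_assignment.
    by case: (u) => [[i [c|]]|[]].
  by rewrite ffunE negb_or => /andP[].
have dCP l : l \in C -> l \notin choice_assignment f.
  by move=> lC; have /pred0P/(_ l) := dC; rewrite /= lC /= => ->.
have wC : (w_, false) \in C.
  (* [x_ o (f o)] is already true, so this is the minimal model. If its free literal were on another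
     variable [u] than [w_], making [u] true would yield a second free literal. *)
  pose o := Ordinal n2; have [//|//|u uC uf] := freeP (x_ o (f o)).
  have [uw|uw] := eqVneq u w_.
    by move: uC; rewrite uw ffunE mem_choice_assignment.
  have [ut|ut] := eqVneq u t_.
    by have := dCP _ uC; rewrite ut ffunE !mem_choice_assignment.
  have [u' uC' uf'] := freeP u uw ut.
  have [] : (u', model u u') = (u, model (x_ o (f o)) u).
    by apply: cC; rewrite inE ?uC ?uC'.
  move=> ->; rewrite [model u u]ffunE eqxx orbT => /esym mu.
  have := dCP _ uC; rewrite mu; move: mu; rewrite ffunE => /orP[->//|/eqP->].
  by rewrite mem_choice_assignment /= eqxx.
have Csub l : l \in C -> l != (w_, false) -> neg l \in choice_assignment f.
  move=> lC; apply: contraNT => nl; apply/eqP; apply: cC; rewrite inE ?lC ?wC //.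
  by rewrite /neg mem_choice_assignment.
apply/eqP; rewrite eqEsubset; apply/andP; split; apply/subsetP => l.
  move=> lC; rewrite inE; have [->|lw] := eqVneq l (w_, false).
    by rewrite inE eqxx.
  by apply/orP; right; rewrite -[l]negK imset_f ?Csub.
rewrite inE => /orP[|/imsetP[[v b] la ->]]; first by rewrite inE => /eqP->.
(* Flipping [v] makes [w_] consistent with the rest of the assignment. *)
pose a : total_assignment svar := [ffun u =>
  match u with
  | inl (i, Some c) => (c == f i) && (v != x_ i (f i))
  | inl (i, None) => v != x_ i (f i)
  | inr c => c || (v == t_)
  end].
have [|u uC] := satP a.
  apply/sat_selector; split=> [i c|az]; first by rewrite !ffunE => /andP[].
  rewrite ffunE /=; move: la; rewrite mem_choice_assignment.
  case: v @a az => [[i [c|]]|[]] a az //= /andP[_ /eqP ec].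
  by have := az i; rewrite ffunE ec => /eqP[].
(* As [w_] is true in [a], the literal of [C] satisfied by [a] is falsified by the choice
   assignment, with which [a] disagrees only at [v]. *)
have uw : (u, a u) != (w_, false).
  by apply/eqP => -[->]; rewrite ffunE.
have := Csub _ uC uw; rewrite /neg /= mem_choice_assignment.
move: la uC; rewrite mem_choice_assignment ffunE.
case: u {uw} => [[i [c|]]|[]] //=.
  move=> la uC /andP[vi /eqP ec]; move: vi la uC.
  rewrite ec eqxx /= negbK => /eqP->; rewrite /x_ eqxx andbT => ->.
  by rewrite eqxx.
move=> la uC; rewrite negbK => /eqP ev.
by move: la uC; rewrite ev /= eqxx => /negbTE->.
Qed.

Lemma choice_clause_inj : injective choice_clause.
Proof.
move=> f g /setP fg; apply/ffunP => i.
have : (x_ i (f i), false) \in choice_clause f.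
  rewrite inE; apply/orP; right; rewrite -[X in X \in _]negK imset_f //.
  by rewrite /neg mem_choice_assignment /= eqxx.
rewrite fg inE => /orP[|/imsetP[[v b] vg]]; first by rewrite inE => /eqP.
case=> e /esym/negbFE eb; move: vg; rewrite -e eb mem_choice_assignment /=.
by move/eqP.
Qed.

Lemma PC_selector_card (psi : cnf svar) :
  1 < n -> PC psi -> equivalent selector psi -> 2 ^ n <= #|psi|.
Proof.
move=> n2 pc eqv.
have -> : 2 ^ n = #|[set choice_clause f | f : {ffun 'I_n -> bool}]|.
  by rewrite card_imset ?card_ffun ?card_bool ?card_ord //; apply: choice_clause_inj.
apply: subset_leq_card; apply/subsetP => _ /imsetP[f _ ->].
have ent : entails (conj_assignment psi (choice_assignment f))
                   (unit_clause (w_, false)).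
  move=> a sat; apply: (@choice_assignment_entails f).
  by move: sat; rewrite !sat_cnf_conj eqv.
(* Either outcome of propagation completeness, the unit clause or the empty one, can be traced back
   to a clause of [psi]. *)
suff [C dC [disC cC]] : exists2 C,
    unit_derives (conj_assignment psi (choice_assignment f)) C &
    [disjoint C & choice_assignment f] /\
    #|[set l in C | neg l \notin choice_assignment f]| <= 1.
  have [D Dpsi [disD cD]] :=
    propagating_clause (@partial_choice_assignment f) dC disC cC.
  rewrite -(propagating_implicate_choice n2 _ disD cD) // => a.
  by rewrite eqv => /forall_inP; apply.
have [d|d] := pc _ _ (@partial_choice_assignment f) ent.
  exists (unit_clause (w_, false)) => //; split.
    by rewrite disjoints1 mem_choice_assignment.
  apply: leq_trans (subset_leq_card _) (eq_leq (cards1 (w_, false))).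
  by apply/subsetP => l; rewrite !inE => /andP[].
exists (empty_clause svar) => //; split; first by rewrite -setI_eq0 set0I.
by apply/card_le1_eqP => l m; rewrite !inE.
Qed.

End Selector.

(** * Exponential against polynomial growth *)

Lemma leq_expn2r m n e : m <= n -> m ^ e <= n ^ e.
Proof. by case: e => // e mn; rewrite leq_exp2r. Qed.

Lemma exp2_beats_monomial (B d : nat) :
  exists2 n, 1 < n & B * n.*2.+1 ^ d < 2 ^ n.
Proof.
(* With [n] a power of two, [2 n + 1 <= 4 n] reduces the claim to exponents:
   [B + (2 j + 4) d < (j + 2) ^ 2 <= n]. *)
pose j := B + 2 * d; exists (2 ^ (2 * j.+1)).
  by rewrite -[1]/(2 ^ 0) ltn_exp2l.
have le1 : (2 ^ (2 * j.+1)).*2.+1 <= 2 ^ (2 * j.+1 + 2).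
  have : 0 < 2 ^ (2 * j.+1) by rewrite expn_gt0.
  by rewrite -muln2 expnD; lia.
apply: (@leq_ltn_trans (2 ^ (B + (2 * j.+1 + 2) * d))).
  rewrite expnD leq_mul ?(ltnW (ltn_expl B _)) // [leqRHS]expnM.
  exact: leq_expn2r.
have lt_j : j.+1 < 2 ^ j.+1 by apply: ltn_expl.
rewrite ltn_exp2l // [X in _ < 2 ^ X]mul2n -addnn expnD.
apply: leq_trans (leq_mul lt_j lt_j); rewrite /j; nia.
Qed.

Import Order.TTheory GRing.Theory Num.Theory.

Local Open Scope ring_scope.

(** [B] exceeds the sum of the absolute values of the coefficients. Since [p] need not be monotone
    and the clause count is only bounded above, [m] and its bound [k] are kept apart. *)
Lemma poly_le_monomial (p : {poly rat}) : exists B : nat,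
  forall m k : nat, (m <= k)%N -> (0 < k)%N ->
  p.[m%:R] <= (B * k ^ size p)%:R.
Proof.
pose S := \sum_(i < size p) `|p`_i|.
exists (Num.trunc S).+1 => m k mk k0.
apply: (@le_trans _ _ (S * (k ^ size p)%:R)); last first.
  by rewrite natrM ler_wpM2r ?ler0n // ltW // truncnS_gt.
rewrite horner_coef mulr_suml; apply: ler_sum => i _.
apply: (le_trans (ler_norm _)); rewrite normrM ler_wpM2l //.
rewrite -natrX ger0_norm ?ler0n // ler_nat.
by apply: leq_trans (leq_pexp2l k0 (ltnW (ltn_ord i))); apply: leq_expn2r.
Qed.

Theorem theorem1 : strictly_more_succinct URC PC.
Proof.
split=> [|[p pP]].
  exists 'X => V phi pc; exists phi; split; first exact: PC_URC.
    by [].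
  by rewrite hornerX.
have [B pB] := poly_le_monomial p.
have [n n2 ltB] := exp2_beats_monomial B (size p).
have [psi [pc eqv le_psi]] := pP _ _ (horn_URC (@horn_selector n)).
have := le_trans le_psi (pB _ _ (card_selector n) isT).
rewrite ler_nat => /(leq_trans (PC_selector_card n2 pc eqv)).
by rewrite leqNgt ltB.
Qed.
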